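(* Let $d\ge 1$ and let $\{G_n\}_{n=1}^\infty$ be a weakly convergent sequence of finite connected simple graphs with all vertex degrees bounded by $d$ and with $\lim_{n\to\infty}|V(G_n)|=\infty$. Then there exists a topological graphing $\mathcal{G}=\{X,T_1,\dots,T_k,\mu\}$ such that for any $r\ge 1$ and any $\mathcal{A}\in\mathcal{U}^{r,d}$, $$\lim_{n\to\infty}p_{G_n}(\mathcal{A})=p_{\mathcal{G}}(\mathcal{A}).$$
   Context: A rooted graph is a simple graph with a distinguished vertex (the root). Two rooted graphs are rooted isomorphic if there is a graph isomorphism between them mapping root to root. A rooted $r$-ball is a rooted graph in which every vertex is at shortest-path distance at most $r$ from the root. For $d\ge1$, $\mathcal{U}^{r,d}$ is the finite set of rooted isomorphism classes of rooted $r$-balls with all vertex degrees bounded by $d$. For a finite graph $G$ with all vertex degrees at most $d$ and $\mathcal{A}\in\mathcal{U}^{r,d}$, let $T(G,\mathcal{A})$ be the set of vertices $v\in V(G)$ such that the $r$-neighborhood $B_r(v)$ (the subgraph induced on the vertices at distance at most $r$ from $v$, rooted at $v$) belongs to the class $\mathcal{A}$. Set $p_G(\mathcal{A}):=|T(G,\mathcal{A})|/|V(G)|$. A sequence $\{G_n\}_{n=1}^\infty$ of finite simple connected graphs with vertex degrees bounded by $d$ and $|V(G_n)|\to\infty$ is weakly convergent if for every $r\ge1$ and every $\mathcal{A}\in\mathcal{U}^{r,d}$ the limit $\lim_{n\to\infty}p_{G_n}(\mathcal{A})$ exists. A topological graphing is a system $\mathcal{G}=\{X,T_1,\dots,T_k,\mu\}$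 where $X$ is a compact metric space, $\mu$ is a Borel measure on $X$, and $T_1,\dots,T_k$ are (finitely many) continuous $\mu$-preserving involutions of $X$ (maps $T_j:X\to X$ with $T_j\circ T_j=\mathrm{id}$). Points $x,y\in X$ are equivalent if $y$ can be reached from $x$ by finitely many successive applications of maps among $T_1,\dots,T_k$. Each equivalence class carries a simple graph structure, its leafgraph: $x$ is adjacent to $y$ iff $x\ne y$ and $T_j(x)=y$ for some $1\le j\le k$. For $\mathcal{A}\in\mathcal{U}^{r,d}$, $p_{\mathcal{G}}(\mathcal{A})$ denotes the $\mu$-measure of the set of points $x\in X$ such that the $r$-neighborhood of $x$ in its leafgraph, rooted at $x$, belongs to the class $\mathcal{A}$. *)

(* Defs.v *)
From HB Require Import structures.
From mathcomp Require Import all_boot all_order all_algebra.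
From mathcomp Require Import all_classical all_reals all_analysis.

Set Implicit Arguments.
Unset Strict Implicit.
Unset Printing Implicit Defensive.

Import Order.TTheory GRing.Theory Num.Theory.
Import numFieldNormedType.Exports.

Local Open Scope classical_set_scope.
Local Open Scope card_scope.
Local Open Scope ring_scope.

(* Simple graphs on arbitrary (possibly infinite) vertex types: finite graphs
   and leafgraphs are both instances, so that the two kinds of r-neighborhood
   can be compared by a single notion of isomorphism. *)
Record sgraph := SGraph {
  vertex :> Type ;
  adj : vertex -> vertex -> Prop ;
  adj_sym : forall u v, adj u v -> adj v u ;
  adj_irr : forall u, ~ adj u u }.

Fixpoint walk (G : sgraph) (n : nat) (u v : G) : Prop :=
  if n is m.+1 then exists2 w : G, adj u w & walk m w v else u = v.

Definition is_dist (G : sgraph) (u v : G) (n : nat) : Prop :=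
  walk n u v /\ forall m, walk m u v -> (n <= m)%N.

Definition dist_le (G : sgraph) (r : nat) (u v : G) : Prop :=
  exists2 n, is_dist u v n & (n <= r)%N.

Lemma dist_le_refl (G : sgraph) (r : nat) (u : G) : dist_le r u u.
Proof. by exists 0%N. Qed.

Definition deg_bounded (d : nat) (G : sgraph) : Prop :=
  forall u : G, [set v | adj u v] #<= `I_d.

Definition induced (G : sgraph) (P : set G) : sgraph :=
  @SGraph {u : G | P u} (fun a b => adj (sval a) (sval b))
    (fun a b => @adj_sym G (sval a) (sval b)) (fun a => @adj_irr G (sval a)).

Record rgraph := RGraph { rg_graph :> sgraph ; rg_root : rg_graph }.

Definition rooted_ball (r : nat) (B : rgraph) : Prop :=
  forall v : B, dist_le r (rg_root B) v.

Definition rooted_iso (B C : rgraph) : Prop :=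
  exists f : B -> C, [/\ bijective f,
    forall u v, adj u v <-> adj (f u) (f v) & f (rg_root B) = rg_root C].

(* Elements are rooted isomorphism classes; they are plain predicates because
   [set rgraph] would be universe-inconsistent with finite types as vertex
   types. *)
Definition rclass := rgraph -> Prop.

Definition ball_classes (r d : nat) (A : rclass) : Prop :=
  exists B : rgraph,
    [/\ rooted_ball r B, deg_bounded d B & A = rooted_iso B].

Definition nbhd (G : sgraph) (r : nat) (v : G) : rgraph :=
  @RGraph (induced [set u | dist_le r v u])
    (exist _ v (dist_le_refl r v)).

Record fin_graph := FinGraph {
  fvertex : finType ;
  fadj : rel fvertex ;
  fadj_sym : forall u v, fadj u v -> fadj v u ;
  fadj_irr : forall u, ~ fadj u u }.

Definition sgraph_of_fin_graph (G : fin_graph) : sgraph :=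
  @SGraph (fvertex G) (fun u v => fadj u v) (@fadj_sym G) (@fadj_irr G).
Coercion sgraph_of_fin_graph : fin_graph >-> sgraph.

(* A connected graph is nonempty by convention. *)
Definition fconnected (G : fin_graph) : Prop :=
  (0 < #|fvertex G|)%N /\ forall u v : fvertex G, connect (@fadj G) u v.

Definition ball_set (G : fin_graph) (r : nat) (A : rclass) : {set fvertex G} :=
  [set v : fvertex G | `[< A (@nbhd G r v) >]]%SET.

Definition ball_freq (R : realType) (r : nat) (A : rclass) (G : fin_graph) : R :=
  #|ball_set G r A|%:R / #|fvertex G|%:R.

Definition weakly_convergent (R : realType) (d : nat) (G : nat -> fin_graph) : Prop :=
  forall (r : nat) (A : rclass), (0 < r)%N -> ball_classes r d A ->
    cvgn (fun n => ball_freq R r A (G n)).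

(* The library requires measurable spaces to be pointed. *)
#[short(type="pmetricType")]
HB.structure Definition PointedMetric (K : numDomainType) :=
  { M of Pointed M & Metric K M }.

Definition borel (X : ptopologicalType) := g_sigma_algebraType (@open X).

Record graphing (R : realType) := Graphing {
  gr_space :> pmetricType R ;
  gr_compact : compact [set: gr_space] ;
  gr_size : nat ;
  gr_map : 'I_gr_size -> gr_space -> gr_space ;
  gr_mu : {measure set (borel gr_space) -> \bar R} ;
  gr_map_continuous : forall j, continuous (gr_map j) ;
  gr_map_involutive : forall j, involutive (gr_map j) ;
  gr_map_preserving : forall j (A : set (borel gr_space)),
    measurable A -> gr_mu (gr_map j @^-1` A) = gr_mu A }.

Section Leafgraph.
Context (R : realType) (X : graphing R).

Definition leaf_equiv (x y : X) : Prop :=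
  exists s : seq 'I_(gr_size X), foldl (fun z j => gr_map j z) x s = y.

Definition leaf_adj (x y : X) : Prop :=
  x <> y /\ exists j : 'I_(gr_size X), gr_map j x = y.

Lemma leaf_adj_sym (x y : X) : leaf_adj x y -> leaf_adj y x.
Proof.
move=> [xy [j jxy]]; split; first exact: nesym.
by exists j; rewrite -jxy gr_map_involutive.
Qed.

Lemma leaf_adj_irr (x : X) : ~ leaf_adj x x.
Proof. by case. Qed.

Definition leafgraph (x : X) : sgraph :=
  @SGraph {y : X | leaf_equiv x y} (fun a b => leaf_adj (sval a) (sval b))
    (fun a b => @leaf_adj_sym (sval a) (sval b))
    (fun a => @leaf_adj_irr (sval a)).

Lemma leaf_equiv_refl (x : X) : leaf_equiv x x.
Proof. by exists [::]. Qed.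

Definition leaf_nbhd (r : nat) (x : X) : rgraph :=
  @nbhd (leafgraph x) r (exist _ x (leaf_equiv_refl x)).

Definition graphing_ball_set (r : nat) (A : rclass) : set (borel X) :=
  [set x : X | A (leaf_nbhd r x)].

Definition graphing_freq (r : nat) (A : rclass) : \bar R :=
  gr_mu X (graphing_ball_set r A).

End Leafgraph.

Arguments graphing_ball_set {R} X r A.
Arguments graphing_freq {R} X r A.

(* Main.v *)
Require Import Defs.
From HB Require Import structures.
From mathcomp Require Import all_boot all_order all_algebra.
From mathcomp Require Import all_classical all_reals all_analysis.

(* Colour the vertices of each G_n, for every s, with a number of colours
   bounded in terms of d and s, so that any two vertices in a common ball of
   radius s get different s-colours.  For a pair of 1-colours, exchanging each
   vertex with its unique neighbour completing the pair is an involution, and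
   these finitely many involutions generate the edges of G_n.

   Let I be the countable set of functions "s-colour of w v is i", with w a word
   in the involutions.  The involutions permute I, hence act continuously on the
   compact space X = {0,1}^I, and each vertex v has an equivariant code in X.
   The ultralimit of the normalized counting measures on the codes is a finitely
   additive invariant content on clopen sets; by compactness it extends to a
   Borel measure mu.

   The isomorphism class of an r-ball is determined by the equalities between
   words of length at most r+1 at its root.  In X the equality of two words is a
   closed condition, contained in the clopen condition that their colours agree.
   The difference is a countable union of clopen sets containing no code, hence
   is mu-null, so up to a null set ball classes are clopen, and their measures
   are ultralimits of the frequencies in G_n. *)

Set Implicit Arguments.
Unset Strict Implicit.
Unset Printing Implicit Defensive.

Import Order.TTheory GRing.Theory Num.Theory.
Import numFieldNormedType.Exports.

Local Open Scope classical_set_scope.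

(** * Balls of graphs presented by words *)

Lemma rooted_iso_sym (B C : Defs.rgraph) : rooted_iso B C -> rooted_iso C B.
Proof.
case=> f [[g fK gK] fadj froot]; exists g; split.
- by exists f.
- by move=> u v; rewrite -{1}(gK u) -{1}(gK v); exact: iff_sym.
- by rewrite -froot fK.
Qed.

Lemma rooted_iso_trans (B C D : Defs.rgraph) :
  rooted_iso B C -> rooted_iso C D -> rooted_iso B D.
Proof.
case=> f [fbij fadj froot] [g [gbij gadj groot]]; exists (g \o f); split.
- exact: bij_comp.
- by move=> u v; exact: iff_trans (fadj u v) (gadj (f u) (f v)).
- by rewrite /= froot groot.
Qed.

Lemma walk_rcons (G : sgraph) n (u v w : G) :
  walk n u v -> adj v w -> walk n.+1 u w.
Proof.
elim: n u => [|n IH] u /=; first by move=> -> vw; exists w.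
by case=> x ux xv vw; exists x => //; exact: IH.
Qed.

Lemma walk_dist_le (G : sgraph) r n (u v : G) :
  walk n u v -> (n <= r)%N -> dist_le r u v.
Proof.
move=> uv nr; have ex : exists n, `[< walk n u v >] by exists n; exact/asboolP.
case: (ex_minnP ex) => m /asboolP um mmin; exists m.
  by split=> // k uk; apply/mmin/asboolP.
by apply: leq_trans nr; apply/mmin/asboolP.
Qed.

Lemma sval_inj (T : Type) (P : T -> Prop) : injective (@sval T P).
Proof. by move=> [x px] [y py] /= xy; exact: eq_exist. Qed.

Section Presentation.
Variable k : nat.
Implicit Types w : seq 'I_k.

(** [ev w] stands for the endpoint of the word [w] read from [h]; a letter may fix a vertex, hence
    the clause [ev w <> u]. An abstract [ev] covers finite graphs and leafgraphs alike. *)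
Definition presents (H : sgraph) (h : H) (ev : seq 'I_k -> H) :=
  ev [::] = h /\
  forall w u, adj (ev w) u <-> ev w <> u /\ exists j, ev (rcons w j) = u.

(** Each edge of a walk is realized by a letter; conversely each letter follows an edge or stays
    put, so a word yields a walk no longer than itself. *)
Lemma presents_dist_le (H : sgraph) (h : H) ev r u : presents h ev ->
  dist_le r h u <-> exists2 w, (size w <= r)%N & ev w = u.
Proof.
move=> [ev0 evadj]; split=> [[n [hu _] nr]|[w wr <-]].
  rewrite -ev0 in hu.
  suff [w wn <-] : exists2 w, size w = n & ev ([::] ++ w) = u.
    by exists w; rewrite ?wn.
  elim: n {nr} [::] hu => [|n IH] w /=; first by exists [::]; rewrite ?cats0.
  case=> v /evadj[_ [j <-]] /IH[w' <- <-].
  by exists (j :: w') => //; rewrite cat_rcons.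
suff [n hn nw] : exists2 n, walk n h (ev w) & (n <= size w)%N.
  by apply: walk_dist_le hn _; exact: leq_trans wr.
elim/last_ind: w {wr} => [|w j [n hn nw]]; first by exists 0%N.
have [wj|wj] := pselect (ev w = ev (rcons w j)).
  by exists n; rewrite -?wj// size_rcons ltnW.
exists n.+1; last by rewrite size_rcons.
by apply: walk_rcons hn _; apply/evadj; split=> //; exists j.
Qed.

(** Vertices reached by the same word correspond. Words of length [r.+1] enter because adjacency
    inside the ball is tested by adding one letter to a word of length at most [r]. *)
Lemma presents_rooted_iso (H H' : sgraph) (h : H) (h' : H') ev ev' r :
  presents h ev -> presents h' ev' ->
  (forall w w', (size w <= r.+1)%N -> (size w' <= r.+1)%N ->
    ev w = ev w' <-> ev' w = ev' w') ->
  rooted_iso (@nbhd H r h) (@nbhd H' r h').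
Proof.
move=> pe pe' ee'.
pose rel (a : nbhd r h) (b : nbhd r h') :=
  exists w, [/\ (size w <= r)%N, ev w = sval a & ev' w = sval b].
have /choice[f fP] : forall a, exists b, rel a b.
  move=> [u hu]; have [w wr wu] := (presents_dist_le r u pe).1 hu.
  have hw : dist_le r h' (ev' w) by apply/(presents_dist_le _ _ pe'); exists w.
  by exists (exist _ (ev' w) hw), w.
have /choice[g gP] : forall b, exists a, rel a b.
  move=> [u hu]; have [w wr wu] := (presents_dist_le r u pe').1 hu.
  have hw : dist_le r h (ev w) by apply/(presents_dist_le _ _ pe); exists w.
  by exists (exist _ (ev w) hw), w.
have relr a b b' : rel a b -> rel a b' -> b = b'.
  move=> [w [wr wa wb]] [w' [w'r w'a w'b]]; apply: sval_inj; rewrite -wb -w'b.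
  by apply/ee'; rewrite ?leqW// wa.
have rell a a' b : rel a b -> rel a' b -> a = a'.
  move=> [w [wr wa wb]] [w' [w'r w'a w'b]]; apply: sval_inj; rewrite -wa -w'a.
  by apply/ee'; rewrite ?leqW// wb.
exists f; split.
- exists g => [a|b]; first exact: rell (gP (f a)) (fP a).
  exact: relr (fP (g b)) (gP b).
- move=> a b /=; have [w [wr <- <-]] := fP a; have [w' [w'r <- <-]] := fP b.
  have jr j : (size (rcons w j) <= r.+1)%N by rewrite size_rcons.
  split=> [/pe.2|/pe'.2] [ww' [j jw']]; [apply/pe'.2|apply/pe.2];
    (split; [move=> eww'; apply/ww'/ee'; rewrite ?leqW//|]);
    by exists j; apply/ee' => //; exact: leqW.
- apply: relr (fP _) _; exists [::].
  by split => //=; [exact: pe.1|exact: pe'.1].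
Qed.
End Presentation.

Local Open Scope ring_scope.

(** * Limits of contents on a compact zero-dimensional space *)

Definition clopen_base (X : topologicalType) :=
  forall (x : X) (A : set X), nbhs x A ->
    exists C, [/\ clopen C, C x & C `<=` A].

(** A copy of [X] whose measurable sets are to be the clopen sets. *)
Definition clopen_algebra (X : Type) : Type := X.

Section ClopenAlgebra.
Context (X : ptopologicalType).
HB.instance Definition _ := Pointed.on (clopen_algebra X).
HB.instance Definition _ := @isAlgebraOfSets.Build default_measure_display
  (clopen_algebra X) (@clopen X) clopen0 clopenU
  (fun A => @clopenC X A A).
End ClopenAlgebra.

Lemma fmap_ultra (S T : Type) (f : S -> T) (F : set_system S) :
  UltraFilter F -> UltraFilter (f @ F).
Proof.
move=> UF; have PF : ProperFilter F by exact: ultra_proper.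
split; first exact: fmap_proper_filter.
move=> G PG FG; apply/seteqP; split=> // A GA.
have [//|FnA] := in_ultra_setVsetC (f @^-1` A) UF.
have GnA : G (~` A) by exact: FG.
have [x [//]] := filter_ex (filterI GA GnA).
Qed.

Section ClopenContent.
Context (R : realType) (X : pmetricType R).
Hypothesis cX : compact [set: X].
Hypothesis bX : clopen_base X.

(** A compact metric space has only countably many clopen sets; in a list of them, those not inside
    [U] are replaced by the empty set. *)
Lemma open_clopen_bigcup (U : set X) : open U ->
  exists F : nat -> set X, (forall n, clopen (F n)) /\ U = \bigcup_n F n.
Proof.
move=> oU; have [f] := clopen_surj cX.
exists (fun n => if `[< f n `<=` U >] then f n else set0); split=> [n|].
  by case: ifPn => _; [exact: (@funS _ _ _ _ f n) | exact: clopen0].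
apply/seteqP; split=> [x Ux|x [n _]]; last first.
  by case: ifPn => // /asboolP; exact.
have [C [cC Cx CU]] := bX (open_nbhs_nbhs (conj oU Ux)).
have [n _ fn] := @surj _ _ _ _ f C cC.
by exists n => //; rewrite fn asboolT.
Qed.

Lemma borel_clopen : @measurable _ (borel X) = <<s @clopen X >>.
Proof.
apply/seteqP; split.
  apply: smallest_sub; first exact: smallest_sigma_algebra.
  move=> U /open_clopen_bigcup[F [cF ->]].
  apply: (@bigcupT_measurable _ (g_sigma_algebraType (@clopen X))) => n.
  exact: sub_sigma_algebra.
apply: smallest_sub; first exact: smallest_sigma_algebra.
by move=> A [oA _]; exact: sub_sigma_algebra.
Qed.

Lemma clopen_measurable (C : set X) :
  clopen C -> measurable (C : set (borel X)).
Proof. by move=> [oC _]; exact: sub_sigma_algebra. Qed.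

Lemma continuous_borel (f : X -> X) : continuous f ->
  measurable_fun [set: borel X] (f : borel X -> borel X).
Proof.
move=> cf; apply: (@measurability _ _ (borel X) (borel X) _ _ (@open X)) => //.
move=> _ [U oU <-]; rewrite setTI; apply: sub_sigma_algebra.
by move/continuousP : cf; exact.
Qed.

Lemma borel_measure_unique (m1 m2 : {measure set (borel X) -> \bar R}) :
  (forall C, clopen C -> m1 C = m2 C) -> (m1 setT < +oo)%E ->
  forall A, measurable A -> m1 A = m2 A.
Proof.
move=> m12 m1oo.
apply: (@measure_unique _ R (borel X) (@clopen X) (fun=> setT)) => //.
- exact: borel_clopen.
- exact: clopenI.
- by move=> _; exact: clopenT.
- by rewrite bigcup_const//; exists 0%N.
Qed.

Section Extension.
Variable nu : set X -> R.
Hypothesis nu0 : nu set0 = 0.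
Hypothesis nu_ge0 : forall C, clopen C -> 0 <= nu C.
Hypothesis nuU : forall C D, clopen C -> clopen D -> C `&` D = set0 ->
  nu (C `|` D) = nu C + nu D.

(** The value 0 off the clopen sets keeps [mu0] nonnegative on all sets. *)
Let mu0 (C : set (clopen_algebra X)) : \bar R :=
  if `[< clopen (C : set X) >] then (nu C)%:E else 0%E.

Let mu00 : mu0 set0 = 0%E.
Proof. by rewrite /mu0; case: ifP => // _; rewrite nu0. Qed.

Let mu0_ge0 C : (0 <= mu0 C)%E.
Proof. by rewrite /mu0; case: ifPn => // /asboolP/nu_ge0; rewrite lee_fin. Qed.

Let mu0_additive2 : additive2 mu0.
Proof.
move=> C D cC cD CD; rewrite /mu0 !asboolT ?nuU//; exact: clopenU.
Qed.

(* A disjoint sequence of open sets with compact union has only finitely many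
   nonempty terms. *)
Let mu0_sigma_additive : semi_sigma_additive mu0.
Proof.
have add : measure_function.semi_additive mu0 by exact/(additive2P mu00).
move=> F cF tF cUF.
have [N FN] : exists N, forall n, (N <= n)%N -> F n = set0.
  have cptU : compact (\bigcup_n F n : set X).
    by apply: (subclosed_compact _ cX) => //; exact: cUF.2.
  move: cptU; rewrite compact_cover => /(_ nat setT F).
  case=> [i _|//|D _ UD]; first exact: (cF i).1.
  exists (\max_(i <- finmap.enum_fset D) i.+1) => n Nn.
  rewrite -subset0 => x Fnx.
  have [i iD Fix] := UD x (ex_intro2 _ _ n I Fnx).
  have ni : n = i by apply: (tF n i) => //; exists x.
  move: Nn; rewrite ni leqNgt => /negP; apply.
  exact: (leq_bigmax_seq i iD).
have UE : \bigcup_n F n = \big[setU/set0]_(n < N) F n.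
  rewrite -bigcup_mkord; apply/seteqP; split=> x [n _ Fnx]; exists n => //=.
  by rewrite ltnNge; apply/negP => /FN F0; rewrite F0 in Fnx.
rewrite UE add -?UE//.
apply: cvg_near_cst; exists N => // n /= Nn.
rewrite -(big_mkord xpredT (fun i => mu0 (F i))) (big_cat_nat _ Nn)//=.
rewrite [X in (_ + X)%E]big_nat_cond [X in (_ + X)%E]big1 ?adde0// => i.
by case/andP => /andP[/FN -> _] _.
Qed.

HB.instance Definition _ := isMeasure.Build _ _ _ mu0 mu00 mu0_ge0
  mu0_sigma_additive.

Lemma clopen_extension : exists mu : {measure set (borel X) -> \bar R},
  forall C, clopen C -> mu C = (nu C)%:E.
Proof.
pose I := g_sigma_algebraType (@measurable _ (clopen_algebra X)).
have mid : measurable_fun [set: I] (idfun : I -> borel X).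
  by move=> _ A mA; rewrite setTI preimage_id; move: mA; rewrite borel_clopen.
(* The Caratheodory extension lives on the sigma-algebra generated by the clopen sets. This is the
   Borel one, so pushing forward along the identity only changes the type. *)
exists (pushforward (measure_extension mu0) (idfun : I -> borel X)) => C cC.
have := measurable_mu_extE mu0 (cC : measurable (C : set (clopen_algebra X))).
rewrite [X in _ = X -> _]/= /mu0 asboolT// => <-.
Unshelve. exact: mid.
Qed.

End Extension.

(** Along an ultrafilter refining [\oo] every sequence in the compact interval [0, 1] converges, and
    the limits inherit finite additivity, so [clopen_extension] applies. *)
Lemma ultralimit_measure (m : nat -> set X -> R) :
  (forall n C, 0 <= m n C <= 1) ->
  (forall n, m n set0 = 0) ->
  (forall n C D, C `&` D = set0 -> m n (C `|` D) = m n C + m n D) ->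
  exists2 U : set_system nat, UltraFilter U /\ \oo `<=` U &
    exists mu : {measure set (borel X) -> \bar R},
      forall C, clopen C -> exists2 l, m n C @[n --> U] --> l & mu C = l%:E.
Proof.
move=> m01 m0 mU; have [U [UU ooU]] := ultraFilterLemma eventually_filter.
have PU : ProperFilter U by exact: ultra_proper.
have mcvg C : cvg (m n C @[n --> U]).
  have := @segment_compact R 0 1; rewrite compact_ultra.
  move=> /(_ (m n C @[n --> U])) [].
  - exact: fmap_ultra.
  - apply: (@filterS _ U _ setT) => [n _|]; last exact: filterT.
    by rewrite /= in_itv/= m01.
  - by move=> l [_ ml]; apply/cvg_ex; exists l.
have [|C cC|C D cC cD CD|mu muE] :=
  clopen_extension (nu := fun C => lim (m n C @[n --> U])).
- by under eq_fun do rewrite m0; exact: lim_cst.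
- by apply: limr_ge => //; apply: nearW => n; case/andP: (m01 n C).
- under eq_fun do rewrite mU//; exact: limD.
exists U => //; exists mu => C cC; exists (lim (m n C @[n --> U])).
  exact: mcvg.
exact: muE.
Qed.

End ClopenContent.

(** * The metric on a countable power of a two-point space *)

Section BoolSpace.
Context (R : realType) (I : Type) (e : nat -> I).
Hypothesis esurj : forall i, exists n, e n = i.

Definition agree (N : nat) (x y : I -> bool) :=
  forall i, (i < N)%N -> x (e i) = y (e i).

Lemma agree_sym N x y : agree N x y -> agree N y x.
Proof. by move=> xy i /xy. Qed.

Lemma agree_trans N x y z : agree N x y -> agree N y z -> agree N x z.
Proof. by move=> xy yz i iN; rewrite xy// yz. Qed.

Lemma agree_le M N x y : (M <= N)%N -> agree N x y -> agree M x y.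
Proof. by move=> MN xy i iM; apply: xy; exact: leq_trans MN. Qed.

Lemma agreeP (x y : I -> bool) : (forall N, agree N x y) -> x = y.
Proof.
by move=> xy; apply: funext => i; have [n <-] := esurj i; exact: (xy n.+1).
Qed.

Lemma disagree (x y : I -> bool) : x <> y -> exists n, x (e n) != y (e n).
Proof.
move=> xy; apply: contrapT => nxy; apply/xy/agreeP => N i _.
by apply/eqP/negPn/negP => ne; apply: nxy; exists i.
Qed.

Definition bool_dist (x y : I -> bool) : R :=
  match pselect (x = y) with
  | left _ => 0
  | right ne => 2^-1 ^+ ex_minn (disagree ne)
  end.

(** Separation, symmetry, the triangle inequality and the description of neighbourhoods all reduce
    to this equivalence. *)
Lemma bool_dist_le N x y : (bool_dist x y <= 2^-1 ^+ N) <-> agree N x y.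
Proof.
rewrite /bool_dist; case: pselect => [->|ne].
  by split=> // _; exact: exprn_ge0.
case: ex_minnP => n nen minn; rewrite ler_iXn2l ?invr_gt0 ?invf_lt1 ?ltr1n//.
split=> [Nn i iN|xy].
  by apply/eqP/negPn/negP => /minn; rewrite leqNgt (leq_trans iN).
by rewrite leqNgt; apply/negP => /xy/eqP; exact/negP.
Qed.

Lemma bool_distxx x : bool_dist x x = 0.
Proof. by rewrite /bool_dist; case: pselect. Qed.

Lemma bool_dist_ge0 x y : 0 <= bool_dist x y.
Proof. by rewrite /bool_dist; case: pselect => // ne; exact: exprn_ge0. Qed.

Lemma bool_dist_eq0 x y : bool_dist x y = 0 -> x = y.
Proof.
by move=> d0; apply: agreeP => N; apply/bool_dist_le; rewrite d0 exprn_ge0.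
Qed.

Lemma bool_distP x y : x = y \/ exists N, bool_dist x y = 2^-1 ^+ N.
Proof.
by rewrite /bool_dist; case: pselect => [|ne]; [left|right; eexists].
Qed.

Lemma bool_dist_sym x y : bool_dist x y = bool_dist y x.
Proof.
wlog suff : x y / bool_dist x y <= bool_dist y x.
  by move=> h; apply/eqP; rewrite eq_le !h.
case: (bool_distP y x) => [->//|[N dN]]; rewrite dN.
by apply/bool_dist_le/agree_sym/bool_dist_le; rewrite dN.
Qed.

(* The distance is an ultrametric. *)
Lemma bool_dist_triangle y x z : bool_dist x z <= bool_dist x y + bool_dist y z.
Proof.
wlog xy : x z / bool_dist x y <= bool_dist y z => [h|].
  have [|/ltW] := leP (bool_dist x y) (bool_dist y z); first exact: h.
  rewrite (bool_dist_sym x z) (bool_dist_sym x y) (bool_dist_sym y z) addrC.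
  by move=> ?; apply: h; rewrite bool_dist_sym (bool_dist_sym y).
suff xz : bool_dist x z <= bool_dist y z.
  by rewrite (le_trans xz)// lerDr bool_dist_ge0.
move: xy; case: (bool_distP y z) => [->//|[N dN]]; rewrite dN => xy.
apply/bool_dist_le/(@agree_trans N x y); first exact/bool_dist_le.
by apply/bool_dist_le; rewrite dN.
Qed.

End BoolSpace.

(* The parameter [R] carries the codomain of the distance, on which the
   library's topology of a metric space depends. *)
Definition bool_space (R : realType) (I : Type) (e : nat -> I)
  of (forall i, exists n, e n = i) : Type := I -> bool.

Section BoolSpaceTopology.
Context (R : realType) (I : Type) (e : nat -> I).
Hypothesis esurj : forall i, exists n, e n = i.
Local Notation X := (bool_space R esurj).

HB.instance Definition _ := Choice.on X.
HB.instance Definition _ := isPointed.Build X (fun=> false).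
HB.instance Definition _ := @isMetric.Build R X (@bool_dist R I e esurj)
  (bool_distxx R esurj) (@bool_dist_eq0 R I e esurj)
  (@bool_dist_sym R I e esurj)  (@bool_dist_triangle R I e esurj).


(** This identifies the metric topology with the product topology. *)
Lemma nbhs_bool_space (x : X) (A : set X) :
  nbhs x A <-> exists N, forall y, agree e N x y -> A y.
Proof.
split=> [/nbhs_ballP[_ /posnumP[r] rA]|[N NA]].
  have half_lt1 : `|2^-1 : R| < 1.
    by rewrite ger0_norm ?invr_ge0// invf_lt1 ?ltr1n.
  have [N _ Nr] := cvgr_lt (0 : R) (cvg_expr half_lt1) r%:num (gt0 r).
  exists N => y xy; apply: rA; rewrite ballEmdist /=.
  apply: (@le_lt_trans _ _ (2^-1 ^+ N)); last exact: (Nr N (leqnn N)).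
  by apply/(@bool_dist_le R I e esurj).
apply/nbhs_ballP; exists (2^-1 ^+ N) => /=.
  by rewrite exprn_gt0 ?invr_gt0.
move=> y; rewrite ballEmdist /= => /ltW xy.
by apply/NA/(@bool_dist_le R I e esurj).
Qed.

Definition finitely_determined (A : set X) :=
  exists N, forall x y, agree e N x y -> A x -> A y.

Lemma finitely_determined_clopen (A : set X) :
  finitely_determined A -> clopen A.
Proof.
move=> [N NA].
have oA (B : set X) : (forall x y, agree e N x y -> B x -> B y) -> open B.
  move=> NB; rewrite openE => x Bx; apply/nbhs_bool_space.
  by exists N => y xy; apply: NB Bx.
split; first exact: oA.
rewrite -openC; apply: oA => x y xy nAx Ay; apply: nAx.
by apply: NA Ay; exact: agree_sym.
Qed.

Lemma bool_space_clopen_base : clopen_base X.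
Proof.
move=> x A /nbhs_bool_space[N NA]; exists [set y | agree e N x y]; split=> //.
apply: finitely_determined_clopen; exists N => y z yz xy.
exact: agree_trans yz.
Qed.

Lemma bool_space_compact : compact [set: X].
Proof.
rewrite compact_ultra => F UF _.
have PF : ProperFilter F by exact: ultra_proper.
(* At each coordinate the limit point takes the value that the ultrafilter [F] selects among the
   two. *)
pose x : X := fun i => `[< F [set y : X | y i] >].
exists x; split=> // A /nbhs_bool_space[N NA].
suff FN : F [set y : X | agree e N x y] by apply: filterS FN => y; exact: NA.
elim: N {NA} => [|N IH].
  by apply: (@filterS _ F _ setT) => [y _ i //|]; exact: filterT.
have FxN : F [set y : X | x (e N) = y (e N)].
  have [FN|FN] := in_ultra_setVsetC [set y : X | y (e N)] UF.
    apply: filterS (FN) => y /= ->; exact: asboolT.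
  apply: filterS (FN) => y /= /negP/negbTE ->; apply: asboolF => FN'.
  by have [z []] := filter_ex (filterI FN FN').
apply: filterS (filterI IH FxN) => y [xy xyN] i.
by rewrite ltnS leq_eqVlt => /predU1P[->|/xy].
Qed.

Lemma reindex_continuous (s : I -> I) :
  continuous ((fun x i => x (s i)) : X -> X).
Proof.
move=> x A /nbhs_bool_space[N NA]; apply/nbhs_bool_space.
suff [M MN] : exists M, forall y z : X, agree e M y z ->
    agree e N (fun i => y (s i)) (fun i => z (s i)).
  by exists M => y xy; apply: NA; exact: MN.
elim: N {NA} => [|N [M MN]]; first by exists 0%N.
have [m em] := esurj (s (e N)); exists (maxn M m.+1) => y z yz i.
rewrite ltnS leq_eqVlt => /predU1P[->|iN].
  by rewrite -em; apply: yz; rewrite leq_max ltnSn orbT.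
by apply: MN iN; apply: agree_le yz; exact: leq_maxl.
Qed.

End BoolSpaceTopology.

(** * Limits of finite systems of involutions *)

Section Patterns.
Context (k : nat) (Y : Type) (T : 'I_k -> Y -> Y).

Definition word (w : seq 'I_k) (y : Y) : Y := foldl (fun z j => T j z) y w.

(** By [presents_rooted_iso], for [L] equal to [r.+1] this finite record determines the isomorphism
    class of the [r]-ball. *)
Definition pattern (L : nat) (y : Y) :=
  [ffun p : L.-bseq 'I_k * L.-bseq 'I_k => `[< word p.1 y = word p.2 y >]].

End Patterns.

(** The set is a finite Boolean combination of the [E p]. An algebra of sets is general enough to
    serve both Borel and clopen sets. *)
Lemma measurable_finite_family d (X : algebraOfSetsType d) (P : finType)
    (E : P -> set X) (S : {set {ffun P -> bool}}) :
  (forall p, measurable (E p)) ->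
  measurable [set x | [ffun p => `[< E p x >]] \in S].
Proof.
move=> mE.
rewrite (_ : [set x | _] = \bigcup_(D in [set` S])
    \bigcap_(p in [set: P]) (if D p then E p else ~` E p)).
  apply: fin_bigcup_measurable => // D _; apply: fin_bigcap_measurable => //.
  by move=> p _; case: ifP => // _; exact: measurableC.
apply/seteqP; split=> x /=.
  move=> xS; exists [ffun p => `[< E p x >]] => //= p _.
  by rewrite ffunE; case: ifPn => /asboolP.
move=> [D DS xD]; rewrite (_ : [ffun p => _] = D)//.
apply/ffunP => p; rewrite ffunE; have := xD p I.
by case: (D p) => h; [exact: asboolT|exact: asboolF].
Qed.

Lemma measure_eq_outside_null d (X : measurableType d) (R : realType)
    (mu : {measure set X -> \bar R}) (A B N : set X) :
  measurable A -> measurable B -> measurable N -> mu N = 0%E ->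
  (forall x, ~ N x -> A x <-> B x) -> mu A = mu B.
Proof.
move=> mA mB mN N0 AB.
have muD C : measurable C -> mu C = mu (C `\` N).
  move=> mC; have mCN : mu (C `&` N) = 0%E.
    apply/eqP; rewrite -measure_le0 -N0; apply: le_measure; rewrite ?inE//.
    exact: measurableI.
  apply: etrans (measureDI mu mC mN) _.
  exact: etrans (congr1 (fun t => mu (C `\` N) + t)%E mCN) (adde0 _).
rewrite muD// [RHS]muD//; congr (mu _).
by apply/seteqP; split=> x [h nN]; split=> //; apply/AB.
Qed.

Section SystemLimit.
Context (R : realType) (k : nat) (V : nat -> finType).
Variable T : forall n, 'I_k -> V n -> V n.
Hypothesis T_invol : forall n j, involutive (@T n j).
Variables (J : countType) (b0 : J) (base : J -> forall n, V n -> bool).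
(** The list [q] depends on neither [n] nor [v]; this uniformity turns equality of two words into
    one clopen condition on the limit space. *)
Hypothesis base_sep : forall w w' : seq 'I_k, exists q : seq J,
  forall n (v : V n), (forall b, b \in q -> base b (word (@T n) w v) =
                                            base b (word (@T n) w' v)) ->
    word (@T n) w v = word (@T n) w' v.

Definition translate (w : seq 'I_k) (b : J) : forall n, V n -> bool :=
  fun n v => base b (word (@T n) w v).

(** Coordinates are functions rather than pairs [(w, b)]: the words [j :: j :: w] and [w] differ but
    yield the same function, which makes translation by a letter an involution. *)
Definition coord : Type :=
  {S : forall n, V n -> bool | exists w b, S = translate w b}.

Definition coord_of w b : coord :=
  exist _ (translate w b) (ex_intro _ w (ex_intro _ b erefl)).

Definition coord_enum (m : nat) : coord :=
  if unpickle m is Some (w, b) then coord_of w b else coord_of [::] b0.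

Lemma coord_enum_surj i : exists m, coord_enum m = i.
Proof.
case: i => S [w [b Swb]]; exists (pickle (w, b)); rewrite /coord_enum pickleK.
exact/sval_inj.
Qed.

Lemma coord_shift_subproof (j : 'I_k) (i : coord) :
  exists w b, (fun n v => sval i n (T j v)) = translate w b.
Proof. by have [w [b ->]] := svalP i; exists (j :: w), b. Qed.

Definition coord_shift j i : coord := exist _ _ (coord_shift_subproof j i).

Lemma coord_shiftK j : involutive (coord_shift j).
Proof.
move=> i; apply: sval_inj => /=; apply: functional_extensionality_dep => n.
by apply: funext => v; rewrite T_invol.
Qed.

Lemma coord_shift_of j w b : coord_shift j (coord_of w b) = coord_of (j :: w) b.
Proof. exact: sval_inj. Qed.

Local Notation X := (bool_space R coord_enum_surj).

Definition shift (j : 'I_k) (x : X) : X := fun i => x (coord_shift j i).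

Definition code n (v : V n) : X := fun i => sval i n v.

Lemma shiftK j : involutive (shift j).
Proof. by move=> x; apply: funext => i; rewrite /shift coord_shiftK. Qed.

Lemma shift_continuous j : continuous (shift j).
Proof. exact: reindex_continuous. Qed.

Lemma word_shift w x u b :
  word shift w x (coord_of u b) = x (coord_of (w ++ u) b).
Proof.
by elim: w x => [//|j w IH] x; rewrite /= IH /shift coord_shift_of.
Qed.

Lemma word_code n (v : V n) w : word shift w (code v) = code (word (@T n) w v).
Proof. by elim: w v => [//|j w IH] v; exact: (IH (T j v)). Qed.

Definition eqset w w' : set X := [set x | word shift w x = word shift w' x].

(* The superset of [eqset w w'] cut out by the finitely many coordinates that
   decide the equality of the two words in the finite systems. *)
Definition sepset w w' : set X :=
  [set x | forall b, b \in sval (cid (base_sep w w')) ->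
             x (coord_of w b) = x (coord_of w' b)].

Lemma eqset_sepset w w' : eqset w w' `<=` sepset w w'.
Proof.
move=> x xww b _; rewrite -(cats0 w) -(cats0 w') -!word_shift.
by rewrite -[word shift w x]/(word shift w x) xww.
Qed.

Lemma code_sepset n (v : V n) w w' :
  sepset w w' (code v) -> word (@T n) w v = word (@T n) w' v.
Proof. exact: (svalP (cid (base_sep w w'))). Qed.

Lemma coord_eq_clopen i i' : clopen [set x : X | x i = x i'].
Proof.
have [m mi] := coord_enum_surj i; have [m' mi'] := coord_enum_surj i'.
apply: finitely_determined_clopen; exists (maxn m m').+1 => x y xy /=.
by rewrite -mi -mi' (xy m) ?(xy m')// ltnS leq_max leqnn ?orbT.
Qed.

Lemma sepset_clopen w w' : clopen (sepset w w').
Proof.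
rewrite /sepset; elim: (sval _) => [|b q IH].
  rewrite (_ : [set x | _] = setT); first exact: clopenT.
  by apply/seteqP; split.
rewrite (_ : [set x | _] =
  [set x : X | x (coord_of w b) = x (coord_of w' b)] `&`
  [set x | forall b, b \in q -> x (coord_of w b) = x (coord_of w' b)]).
  by apply: clopenI => //; exact: coord_eq_clopen.
apply/seteqP; split=> x /= h.
  by split=> [|c cq]; apply: h; rewrite inE ?eqxx ?cq ?orbT.
by move=> c; rewrite inE => /predU1P[->|]; [exact: h.1|exact: h.2].
Qed.

Definition coordset w w' m : set X :=
  [set x | word shift w x (coord_enum m) = word shift w' x (coord_enum m)].

Lemma coordset_clopen w w' m : clopen (coordset w w' m).
Proof.
rewrite /coordset; have [w1 [b ->]] : exists w b, coord_enum m = coord_of w b.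
  rewrite /coord_enum; case: unpickle => [[w1 b]|]; first by exists w1, b.
  by exists [::], b0.
under eq_set do rewrite !word_shift; exact: coord_eq_clopen.
Qed.

Lemma eqsetE w w' : eqset w w' = \bigcap_m coordset w w' m.
Proof.
apply/seteqP; split=> x; first by move=> xww m _; rewrite /coordset /= xww.
move=> h; apply: funext => i; have [m <-] := coord_enum_surj i; exact: h.
Qed.

Lemma eqset_measurable w w' : measurable (eqset w w' : set (borel X)).
Proof.
rewrite eqsetE; apply: bigcapT_measurable => m.
by apply: clopen_measurable; exact: coordset_clopen.
Qed.

Definition freq n (C : set X) : R :=
  #|[set v : V n | `[< C (code v) >]]%SET|%:R / #|V n|%:R.

Lemma freq01 n C : 0 <= freq n C <= 1.
Proof.
(* For an empty [V n] the quotient is 0, since the inverse of 0 is 0. *)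
rewrite /freq divr_ge0//=; have [->|V0] := posnP #|V n|.
  by rewrite invr0 mulr0.
by rewrite ler_pdivrMr ?ltr0n// mul1r ler_nat max_card.
Qed.

Lemma freq0 n C : (forall v : V n, ~ C (code v)) -> freq n C = 0.
Proof.
move=> Cv; rewrite /freq (_ : [set v | _]%SET = finset.set0) ?cards0 ?mul0r//.
by apply/finset.setP => v; rewrite !inE; exact: asboolF.
Qed.

Lemma freqU n C D : C `&` D = set0 -> freq n (C `|` D) = freq n C + freq n D.
Proof.
move=> CD; rewrite /freq -mulrDl -natrD -cardsUI.
rewrite (_ : (_ :&: _)%SET = finset.set0) ?cards0 ?addn0.
  congr (#|pred_of_set _|%:R / _); apply/finset.setP => v.
  by rewrite !inE asbool_or.
apply/finset.setP => v; rewrite !inE -asbool_and; apply: asboolF => CDv.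
by have : (C `&` D) (code v) by []; rewrite CD.
Qed.

(** Codes are equivariant and [T j] permutes [V n], so the vertices counted are merely permuted. *)
Lemma freq_shift n j C : freq n (shift j @^-1` C) = freq n C.
Proof.
rewrite /freq; congr (_%:R / _).
rewrite -(card_preimset [set v | `[< C (code v) >]]%SET
                        (inv_inj (@T_invol n j))).
apply: eq_card => v; rewrite !inE; congr `[< C _ >].
Qed.

Definition pattern_set L
    (S : {set {ffun L.-bseq 'I_k * L.-bseq 'I_k -> bool}}) : set X :=
  [set x | pattern shift L x \in S].

Lemma system_limit :
  exists2 U : set_system nat, UltraFilter U /\ \oo `<=` U &
  exists mu : {measure set (borel X) -> \bar R},
    (forall j (A : set (borel X)), measurable A ->
      mu (shift j @^-1` A) = mu A) /\
    forall L S, measurable (@pattern_set L S : set (borel X)) /\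
      exists2 l : R,
        #|[set v : V n | pattern (@T n) L v \in S]%SET|%:R / #|V n|%:R
          @[n --> U] --> l & mu (@pattern_set L S) = l%:E.
Proof.
have cX := @bool_space_compact R _ _ coord_enum_surj.
have bX := @bool_space_clopen_base R _ _ coord_enum_surj.
have [U [UU ooU] [mu muP]] := ultralimit_measure cX bX freq01
  (fun n => @freq0 n set0 (fun v => id)) freqU.
have PU : ProperFilter U by exact: ultra_proper.
exists U => //; exists mu; split=> [j A mA|L S].
  have mj := continuous_borel (@shift_continuous j).
  apply/esym; pose mu' := pushforward mu (shift j : borel X -> borel X).
  suff : forall A, measurable A -> mu A = mu' A by exact.
  (* On a clopen set, [mu] and its pushforward are limits of the same frequencies by
     [freq_shift]. *)
  apply: (@borel_measure_unique R X cX bX) => [C cC|].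
    have [l ml ->] := muP _ cC.
    have cC' : clopen (shift j @^-1` C).
      by apply: preimage_clopen cC _; exact: shift_continuous.
    have [l' ml' mE'] := muP _ cC'; apply: etrans (esym mE').
    congr _%:E; apply: (@cvg_unique _ _ (freq n C @[n --> U])) => //.
    rewrite (_ : (fun n => freq n C) = (fun n => freq n (shift j @^-1` C)))//.
    by apply: funext => n; rewrite freq_shift.
  by have [l _ ->] := muP _ clopenT; exact: ltry.
have mS : measurable (@pattern_set L S : set (borel X)).
  rewrite /pattern_set; apply: measurable_finite_family => p.
  exact: eqset_measurable.
split=> //.
(* [B] is the clopen substitute for the pattern set. On codes the two conditions coincide, so its
   frequencies are those of the patterns. *)
pose B : set X := [set x | [ffun p : L.-bseq 'I_k * L.-bseq 'I_k =>
  `[< sepset p.1 p.2 x >]] \in S].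
have cB : clopen B.
  apply: (@measurable_finite_family _ (clopen_algebra X)) => p.
  exact: sepset_clopen.
have [l Bl muB] := muP B cB; exists l.
  suff -> : (fun n =>
      #|[set v : V n | pattern (@T n) L v \in S]%SET|%:R / #|V n|%:R) =
      (fun n => freq n B) by [].
  apply: funext => n; rewrite /freq; congr (#|pred_of_set _|%:R / _).
  apply/finset.setP => v; rewrite !inE /B /= asboolb; congr (_ \in S).
  apply/ffunP => p; rewrite !ffunE; apply: asbool_equiv_eq; split=> [vv|].
    by apply: eqset_sepset; rewrite /eqset /= !word_code vv.
  exact: code_sepset.
rewrite -muB.
(* A point of [sepset u w] outside [eqset u w] violates some coordinate [m], so the [F i] exhaust
   the exceptional points. Numbers that encode no triple contribute the empty set. *)
pose F i : set X :=
  if unpickle i is Some (p, m) then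
    (let: (u, w) := p : L.-bseq 'I_k * L.-bseq 'I_k in
     sepset u w `\` coordset u w m)
  else set0.
have cF i : clopen (F i).
  rewrite /F; case: unpickle => [[[u w] m]|]; last exact: clopen0.
  apply: clopenI; first exact: sepset_clopen.
  by apply: clopenC => //; exact: coordset_clopen.
have muF i : mu (F i) = 0%E.
  have [l0 Fl0 ->] := muP _ (cF i); congr _%:E; apply/esym.
  apply: (@cvg_unique _ _ (freq n (F i) @[n --> U])) => //.
  rewrite (_ : (fun n => freq n (F i)) = (fun=> 0)); first exact: cvg_cst.
  apply: funext => n; apply: freq0 => v; rewrite /F.
  case: unpickle => [[[u w] m] [/code_sepset uw]|//]; apply.
  by rewrite /coordset /= !word_code uw.
have mF i : measurable (F i : set (borel X)) by exact: clopen_measurable.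
have mN : measurable (\bigcup_i F i : set (borel X)).
  exact: bigcupT_measurable.
have muN : mu (\bigcup_i F i) = 0%E.
  apply: measure_negligible => //; apply: negligible_bigcup => i.
  by apply/negligibleP; [exact: mF|exact: muF].
apply: (measure_eq_outside_null mS _ mN muN); first exact: clopen_measurable.
move=> x Nx; rewrite /pattern_set /B /=.
suff -> : pattern shift L x =
  [ffun p : L.-bseq 'I_k * L.-bseq 'I_k => `[< sepset p.1 p.2 x >]] by [].
apply/ffunP => p; rewrite !ffunE; apply: asbool_equiv_eq; split.
  exact: eqset_sepset.
move=> sx; rewrite -[_ = _]/(eqset p.1 p.2 x) eqsetE => m _.
apply: contrapT => nx; apply: Nx; exists (pickle (p, m)) => //.
by rewrite /F pickleK; case: p sx nx.
Qed.

Definition limit_graphing (mu : {measure set (borel X) -> \bar R})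
    (mu_inv : forall j (A : set (borel X)), measurable A ->
      mu (shift j @^-1` A) = mu A) : graphing R :=
  @Graphing R X (@bool_space_compact R _ _ coord_enum_surj) k shift mu
    shift_continuous shiftK mu_inv.

End SystemLimit.

Local Close Scope ring_scope.

(** * Colourings *)

Lemma card_bigcup_leq (V : finType) (A : {set V}) (F : V -> {set V}) b :
  (forall w, #|F w| <= b)%N -> (#|\bigcup_(w in A) F w|%SET <= #|A| * b)%N.
Proof.
move=> Fb; rewrite -sum_nat_const.
apply: (big_ind2 (fun (B : {set V}) m => #|B| <= m)%N) => [|B m C n Bm Cn|//].
  by rewrite cards0.
by apply: leq_trans (leq_card_setU B C) _; exact: leq_add.
Qed.

Lemma greedy_coloring (V : finType) (e : rel V) D :
  (forall u v, e u v -> e v u) -> (forall u, ~~ e u u) ->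
  (forall u, #|[set v | e u v]%SET| <= D)%N ->
  exists c : V -> 'I_D.+1, forall u v, e u v -> c u != c v.
Proof.
move=> esym eirr eD.
suff [c cP] : exists c : V -> 'I_D.+1,
    {in enum V &, forall u v, e u v -> c u != c v}.
  by exists c => u v; apply: cP; rewrite mem_enum.
(* Vertices are coloured one at a time. The at most [D] neighbours of [x], listed or not, leave one
   of the [D.+1] colours free. *)
elim: (enum V) => [|x s [c cP]]; first by exists (fun=> ord0).
have [a] : exists a, a \notin [set c v | v in [set v | e x v]]%SET.
  apply/existsP; rewrite -negb_forall; apply/negP => /forallP all_used.
  have := leq_trans (leq_imset_card c [set v | e x v]%SET) (eD x).
  apply/negP; rewrite -ltnNge -{1}(card_ord D.+1); apply/subset_leq_card.
  by apply/fintype.subsetP => i _; exact: all_used.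
move=> afresh; have {}afresh v : e x v -> a != c v.
  by move=> xv; apply: contraNneq afresh => ->; apply: imset_f; rewrite inE.
exists (fun v => if v == x then a else c v) => u v; rewrite !inE.
have [->|ux] := eqVneq u x; have [->|vx] := eqVneq v x => //= us vs uv.
- by rewrite (negbTE (eirr x)) in uv.
- exact: afresh.
- by rewrite eq_sym; apply: afresh; exact: esym.
- exact: cP.
Qed.

Section FiniteBalls.
Context (d : nat) (V : finType) (e : rel V).
Hypothesis esym : forall u v, e u v -> e v u.
Hypothesis edeg : forall u, (#|[set v | e u v]%SET| <= d)%N.

Fixpoint fball n u : {set V} :=
  if n is m.+1 then (\bigcup_(w in fball m u) (w |: [set v | e w v]))%SET
  else [set u]%SET.

Lemma card_fball n u : (#|fball n u| <= d.+1 ^ n)%N.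
Proof.
elim: n => [|n IH] /=; first by rewrite cards1.
rewrite expnSr; apply: leq_trans (_ : #|fball n u| * d.+1 <= _)%N; last first.
  by rewrite leq_mul2r IH orbT.
apply: card_bigcup_leq => w; rewrite cardsU1 -add1n leq_add ?edeg//.
by case: (_ \notin _).
Qed.

Lemma fball_add m n u v w : v \in fball m u -> w \in fball n v ->
  w \in fball (m + n) u.
Proof.
move=> uv; elim: n w => [|n IH] w /=; first by rewrite inE addn0 => /eqP->.
case/bigcupP => x /IH ux xw; rewrite addnS; apply/bigcupP; by exists x.
Qed.

Lemma fball1 u v : (v \in fball 1 u) = (v == u) || e u v.
Proof. by rewrite /= big_set1 !inE. Qed.

Lemma fball_sym n u v : v \in fball n u -> u \in fball n v.
Proof.
elim: n v => [|n IH] v /=; first by rewrite !inE eq_sym.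
case/bigcupP => w /IH wu; rewrite !inE => vw.
apply: (@fball_add 1 n v w u _ wu); rewrite fball1.
by case/orP: vw => [/eqP->|/esym ->]; rewrite ?eqxx ?orbT.
Qed.

Lemma fball_leq m n u : (m <= n)%N -> fball m u \subset fball n u.
Proof.
move=> mn; rewrite -(subnKC mn); apply/fintype.subsetP => v uv.
apply: fball_add uv _; elim: (n - m)%N => [|p IH] /=; first by rewrite inE.
by apply/bigcupP; exists v => //; rewrite !inE eqxx.
Qed.

(** Greedy colouring is applied to the graph joining distinct vertices that share a ball of radius
    [s]; these lie within [s + s] of each other, which bounds the degree. *)
Lemma ball_coloring s : exists c : V -> 'I_(d.+1 ^ (s + s)).+1,
  forall z u v, u \in fball s z -> v \in fball s z -> c u = c v -> u = v.
Proof.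
pose near u v := (u != v) && [exists z, (u \in fball s z) && (v \in fball s z)].
have [|u|u|c cP] := @greedy_coloring V near (d.+1 ^ (s + s)).
- move=> u v /andP[uv /existsP[z uz]]; rewrite /near eq_sym uv.
  by apply/existsP; exists z; rewrite andbC.
- by rewrite /near eqxx.
- apply: leq_trans (card_fball (s + s) u).
  apply/subset_leq_card/fintype.subsetP => v.
  rewrite inE => /andP[_ /existsP[z /andP[uz vz]]].
  exact: fball_add (fball_sym uz) vz.
- exists c => z u v uz vz cuv; apply/eqP/negPn/negP => uv.
  have /cP : near u v by rewrite /near uv; apply/existsP; exists z; rewrite uz.
  by rewrite cuv eqxx.
Qed.

End FiniteBalls.

(** * Involutions defined by pairs of colours *)

Section ColorInvolutions.
Context (m : nat) (V : finType) (e : rel V) (c : V -> 'I_m).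
Hypothesis esym : forall u v, e u v -> e v u.
Hypothesis c_inj : forall v u u', e v u -> e v u' -> c u = c u' -> u = u'.

(* The partner of v along the colour pair (a, b) is its unique neighbour whose
   colour together with that of v forms the pair. *)
Definition partner (p : 'I_m * 'I_m) (v u : V) :=
  e v u && ((p == (c v, c u)) || (p == (c u, c v))).

Definition swap p v := odflt v [pick u | partner p v u].

Lemma partner_sym p v u : partner p v u -> partner p u v.
Proof. by case/andP=> /esym vu; rewrite /partner vu /= orbC. Qed.

Lemma partner_uniq p v u u' : partner p v u -> partner p v u' -> u = u'.
Proof.
case/andP=> vu pu /andP[vu' pu']; apply: c_inj vu vu' _.
case/orP: pu => /eqP pE; case/orP: pu'; rewrite pE => /eqP[].
- by [].
- by move=> -> ->.
- by move=> -> ->.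
- by [].
Qed.

Lemma swap_partner p v u : partner p v u -> swap p v = u.
Proof.
move=> vu; rewrite /swap; case: pickP => [u' /partner_uniq|/(_ u)].
  by move=> /(_ _ vu).
by rewrite vu.
Qed.

(** Partners are unique and the relation is symmetric, so they are exchanged; a vertex without
    partner is fixed. *)
Lemma swapK p : involutive (swap p).
Proof.
move=> v; have [u|nvu] := pickP (partner p v).
  by move=> vu; rewrite (swap_partner vu); apply/swap_partner/partner_sym.
rewrite /swap; case: pickP => [u|_]; first by rewrite nvu.
by rewrite /=; case: pickP => // u; rewrite nvu.
Qed.

Lemma swap_adj p v : swap p v != v -> e v (swap p v).
Proof.
rewrite /swap; case: pickP => [u /andP[]|_] //=; by rewrite eqxx.
Qed.

Lemma adj_swap v u : e v u -> swap (c v, c u) v = u.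
Proof. by move=> vu; apply: swap_partner; rewrite /partner vu eqxx. Qed.

End ColorInvolutions.

Lemma deg_bounded_card d (G : fin_graph) : deg_bounded d G ->
  forall u, (#|[set v | @fadj G u v]%SET| <= d)%N.
Proof.
move=> Gd u; have := geq_card_fset_set (Gd u); apply: leq_trans.
rewrite cardE; apply: uniq_leq_size (enum_uniq _) _ => v.
rewrite mem_enum inE => uv; rewrite in_fset_set; last exact: finite_finset.
exact: mem_set.
Qed.

(** * The system of involutions of the graph sequence *)

Section GraphSystem.
Context (d : nat) (G : nat -> fin_graph).
Hypothesis hdeg : forall n, deg_bounded d (G n).

Let edeg n := deg_bounded_card (@hdeg n).

(** The count does not depend on [n], so one finite set of generators serves all graphs. *)
Definition color_count s := (d.+1 ^ (s + s)).+1.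

Definition color s n : fvertex (G n) -> 'I_(color_count s) :=
  sval (cid (ball_coloring (@fadj_sym (G n)) (@edeg n) s)).

Lemma color_inj s n z u v : u \in fball (@fadj (G n)) s z ->
  v \in fball (@fadj (G n)) s z -> color s u = color s v -> u = v.
Proof. exact: (svalP (cid (ball_coloring _ _ _))). Qed.

Lemma color_nbr_inj n v u u' : @fadj (G n) v u -> @fadj (G n) v u' ->
  color 1 u = color 1 u' -> u = u'.
Proof.
by move=> vu vu'; apply: (@color_inj 1 n v); rewrite fball1 ?vu ?vu' orbT.
Qed.

Definition gen_count := #|{: 'I_(color_count 1) * 'I_(color_count 1)}|.

Definition gen n (j : 'I_gen_count) : fvertex (G n) -> fvertex (G n) :=
  swap (@fadj (G n)) (@color 1 n) (enum_val j).

Lemma genK n j : involutive (@gen n j).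
Proof. by apply: swapK; [exact: fadj_sym|exact: color_nbr_inj]. Qed.

Lemma gen_adjP n v u : @fadj (G n) v u <-> v <> u /\ exists j, gen j v = u.
Proof.
split=> [vu|[vu [j ju]]].
  split; first by move=> vu'; rewrite vu' in vu; exact: fadj_irr vu.
  exists (enum_rank (color 1 v, color 1 u)); rewrite /gen enum_rankK.
  exact: (adj_swap (@color_nbr_inj n)).
rewrite -ju; apply: swap_adj; apply/eqP; rewrite -/(gen j v) ju.
exact: nesym.
Qed.

Lemma word_presents n (v : fvertex (G n)) :
  presents (v : G n) (fun w => word (@gen n) w v : G n).
Proof.
split=> // w u; rewrite [adj _ _]/(is_true _) /=.
split=> [/gen_adjP|] [wu [j ju]].
  by split=> //; exists j; rewrite /word -cats1 foldl_cat.
by apply/gen_adjP; split=> //; exists j; rewrite -ju /word -cats1 foldl_cat.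
Qed.

Lemma word_fball n (v : fvertex (G n)) w :
  word (@gen n) w v \in fball (@fadj (G n)) (size w) v.
Proof.
elim/last_ind: w => [|w j IH]; first by rewrite inE.
rewrite size_rcons /word -cats1 foldl_cat /=; apply/bigcupP.
exists (word (@gen n) w v) => //; rewrite !inE.
have [//|wj] := eqVneq; exact: swap_adj.
Qed.

(** Pairs of naturals index the colours for all radii at once; a second component beyond the colour
    range gives the constant [false]. *)
Definition base (b : nat * nat) n (v : fvertex (G n)) : bool :=
  color b.1 v == b.2 :> nat.

(** Both endpoints lie in the ball of radius [s] around [v], where the [s]-colour is injective, and
    the finitely many listed tests determine that colour. *)
Lemma base_sep (w w' : seq 'I_gen_count) : exists q : seq (nat * nat),
  forall n (v : fvertex (G n)),
    (forall b, b \in q ->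
      base b (word (@gen n) w v) = base b (word (@gen n) w' v)) ->
    word (@gen n) w v = word (@gen n) w' v.
Proof.
pose s := maxn (size w) (size w').
exists [seq (s, i) | i <- iota 0 (color_count s)] => n v sep.
have sub w1 : (size w1 <= s)%N ->
    word (@gen n) w1 v \in fball (@fadj (G n)) s v.
  by move=> ws; apply: fintype.subsetP (word_fball v w1); exact: fball_leq.
apply: (@color_inj s n v); [exact/sub/leq_maxl|exact/sub/leq_maxr|].
have cq : (s, val (color s (word (@gen n) w v))) \in
    [seq (s, i) | i <- iota 0 (color_count s)].
  by apply: map_f; rewrite mem_iota add0n ltn_ord.
by move: (sep _ cq); rewrite /base /= eqxx => /esym/eqP wv; exact/esym/val_inj.
Qed.

End GraphSystem.

(** * Leafgraphs and convergence of the ball frequencies *)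

Lemma leaf_presents (R : realType) (X : graphing R) (x : X) :
  presents (exist _ x (leaf_equiv_refl x) : leafgraph x)
    (fun w => exist _ (word (@gr_map R X) w x) (ex_intro _ w erefl) :
       leafgraph x).
Proof.
split=> [|w u]; first exact: sval_inj.
have wj j : word (@gr_map R X) (rcons w j) x =
    gr_map j (word (@gr_map R X) w x).
  by rewrite /word -cats1 foldl_cat.
split=> [[/= wu [j ju]]|[wu [j ju]]].
  split=> [wu'|]; first by apply: wu; rewrite -wu'.
  by exists j; apply: sval_inj; rewrite /= wj.
split=> /=; first by move=> wu'; apply: wu; exact: sval_inj.
by exists j; rewrite -wj -ju.
Qed.

Lemma pattern_eqP k (Y Z : Type) (T : 'I_k -> Y -> Y) (T' : 'I_k -> Z -> Z)
    L y z :
  pattern T L y = pattern T' L z ->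
  forall w w', (size w <= L)%N -> (size w' <= L)%N ->
  word T w y = word T w' y <-> word T' w z = word T' w' z.
Proof.
move=> /ffunP yz w w' wL w'L; have := yz (Bseq wL, Bseq w'L).
by rewrite !ffunE => ww; exact: asbool_eq_equiv ww.
Qed.

(* The measurability conjunct makes explicit that the value of the measure on
   this set is meaningful: the library's measures are total functions. *)
Theorem theorem1 (R : realType) (d : nat) (G : nat -> fin_graph)
    (hd : (0 < d)%N)
    (hconn : forall n, fconnected (G n))
    (hdeg : forall n, deg_bounded d (G n))
    (hsize : (fun n => #|fvertex (G n)|) @ \oo --> \oo)
    (hweak : weakly_convergent R d G) :
  exists X : graphing R,
    forall (r : nat) (A : rclass), (0 < r)%N -> ball_classes r d A ->
      measurable (graphing_ball_set X r A) /\
      (fun n => (ball_freq R r A (G n))%:E) @ \oo --> graphing_freq X r A.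
Proof.
pose gk := gen_count d; pose T n := @gen d G hdeg n.
have [U [UU ooU] [mu [mu_inv muP]]] :=
  system_limit R (@genK d G hdeg) (0%N, 0%N) (@base_sep d G hdeg).
have PU : ProperFilter U by exact: ultra_proper.
pose X := limit_graphing (@genK d G hdeg) mu_inv; exists X.
move=> r A r0 Ar.
have [B [_ _ AE]] := Ar.
have A_iso C D : rooted_iso C D -> A C <-> A D.
  move=> CD; rewrite AE; split=> BC; first exact: rooted_iso_trans CD.
  exact/(rooted_iso_trans BC)/rooted_iso_sym.
(* Patterns are collected from the finite graphs and from [X] together, so that the same [S]
   characterizes [A] on both sides. *)
pose S := [set D : {ffun r.+1.-bseq 'I_gk * r.+1.-bseq 'I_gk -> bool} | `[<
  (exists n (v : G n), pattern (@T n) r.+1 v = D /\ A (nbhd r v)) \/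
  exists x : X, pattern (@gr_map R X) r.+1 x = D /\ A (leaf_nbhd r x) >]]%SET.
have SX (x : X) : A (leaf_nbhd r x) <-> pattern (@gr_map R X) r.+1 x \in S.
  split=> [Ax|]; first by rewrite inE; apply/asboolP; right; exists x.
  rewrite inE => /asboolP[[n [v]]|[y]] [pE]; apply: (A_iso _ _ _).1.
    apply: presents_rooted_iso (word_presents hdeg v) (leaf_presents x) _.
    move=> w w' wr w'r; apply: iff_trans (pattern_eqP pE wr w'r) _.
    by split=> [ww|/(congr1 sval)//]; exact: sval_inj.
  apply: presents_rooted_iso (leaf_presents y) (leaf_presents x) _.
  move=> w w' wr w'r; split=> [/(congr1 sval)|/(congr1 sval)] /=;
    by move=> /(pattern_eqP pE wr w'r) ww; exact: sval_inj.
have SG n (v : G n) : A (nbhd r v) <-> pattern (@T n) r.+1 v \in S.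
  split=> [Ax|]; first by rewrite inE; apply/asboolP; left; exists n, v.
  rewrite inE => /asboolP[[n' [v']]|[y]] [pE]; apply: (A_iso _ _ _).1.
    apply: presents_rooted_iso (word_presents hdeg v') (word_presents hdeg v) _.
    exact: pattern_eqP pE.
  apply: presents_rooted_iso (leaf_presents y) (word_presents hdeg v) _.
  move=> w w' wr w'r; apply: iff_trans (_ : _ <-> _) (pattern_eqP pE wr w'r).
  by split=> [/(congr1 sval)//|ww]; exact: sval_inj.
have XS : graphing_ball_set X r A = pattern_set S.
  by apply/seteqP; split=> x /SX.
have [mS [l Sl muS]] := muP r.+1 S.
split; first by rewrite XS.
rewrite /graphing_freq XS.
have /cvg_ex[/= p freqp] := hweak r A r0 Ar.
(* [U] refines [\oo], so the limit given by weak convergence is also the limit along [U]. *)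
have pl : p = l.
  apply: (@cvg_unique _ _ (ball_freq R r A (G n) @[n --> U])) => //.
    by apply: cvg_trans freqp; apply: cvg_app.
  suff -> : (fun n => ball_freq R r A (G n)) =
      fun n => (#|[set v | pattern (@T n) r.+1 v \in S]%SET|%:R /
                #|fvertex (G n)|%:R)%R.
    exact: Sl.
  apply: funext => n; congr (#|pred_of_set _|%:R / _)%R.
  apply/finset.setP => v; rewrite [LHS]inE [RHS]inE.
  by apply/asboolP/idP => /SG.
rewrite [X in _ --> X]muS -pl; apply: cvg_EFin; first by apply: nearW.
exact: freqp.
Qed.
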